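(* Let $p$ be a prime, let $q\in\mathbb{C}_p$ with $|1-q|_p<1$, let $r\in\mathbb{N}$, let $x\in\mathbb{Z}_p$, and let $w_1,w_2\in\mathbb{N}$ with $w_1\equiv 1 \pmod 2$ and $w_2\equiv 1\pmod 2$. Then, as formal power series in $t$, \begin{align*} &\sum_{j_1,\dots,j_r=0}^{w_1-1}(-1)^{j_1+\cdots+j_r}\int_{\mathbb{Z}_p}\cdots\int_{\mathbb{Z}_p} e^{[w_1]_q\left[w_2x+\frac{w_2}{w_1}(j_1+\cdots+j_r)+y_1+\cdots+y_r\right]_{q^{w_1}}t}\,d\mu_{-1}(y_1)\cdots d\mu_{-1}(y_r)\\ =&\sum_{j_1,\dots,j_r=0}^{w_2-1}(-1)^{j_1+\cdots+j_r}\int_{\mathbb{Z}_p}\cdots\int_{\mathbb{Z}_p} e^{[w_2]_q\left[w_1x+\frac{w_1}{w_2}(j_1+\cdots+j_r)+y_1+\cdots+y_r\right]_{q^{w_2}}t}\,d\mu_{-1}(y_1)\cdots d\mu_{-1}(y_r). \end{align*}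
   Context: $\mathbb{Z}_p$, $\mathbb{Q}_p$, $\mathbb{C}_p$ denote the $p$-adic integers, $p$-adic numbers, and the completion of an algebraic closure of $\mathbb{Q}_p$. For $q\in\mathbb{C}_p$ with $|1-q|_p<1$, the $q$-number is $[z]_q=\frac{1-q^z}{1-q}$. The expression $[w_2x+\frac{w_2}{w_1}J+Y]_{q^{w_1}}$ (with $J=j_1+\cdots+j_r$, $Y=y_1+\cdots+y_r$) is understood as $\frac{1-q^{w_1w_2x+w_2J+w_1Y}}{1-q^{w_1}}$, so that $[w_1]_q[w_2x+\frac{w_2}{w_1}J+Y]_{q^{w_1}}=[w_1w_2x+w_2J+w_1Y]_q$; similarly with $w_1,w_2$ interchanged. For a continuous $f:\mathbb{Z}_p\to\mathbb{C}_p$, the fermionic $p$-adic integral is $\int_{\mathbb{Z}_p}f(y)\,d\mu_{-1}(y)=\lim_{N\to\infty}\sum_{y=0}^{p^N-1}f(y)(-1)^y$; the multiple integral is the iterated such integral in $y_1,\dots,y_r$. An integral of $e^{g(y_1,\dots,y_r)t}$ is understood coefficientwise: $\sum_{n\ge0}\left(\int\cdots\int g^n\,d\mu_{-1}(y_1)\cdots d\mu_{-1}(y_r)\right)\frac{t^n}{n!}$. *)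

(* Defs.v *)
From HB Require Import structures.
From mathcomp Require Import all_boot all_order all_algebra.
From mathcomp Require Import all_classical all_reals all_analysis.

Set Implicit Arguments.
Unset Strict Implicit.
Unset Printing Implicit Defensive.

Import Order.TTheory GRing.Theory Num.Theory.

Local Open Scope classical_set_scope.
Local Open Scope ring_scope.

(* The libraries have no p-adic fields, so C_p is described by its definition:
   a [padicComplex p R] is a completion of an algebraic closure of Q_p, with its
   absolute value taking values in [R].  Inside such a field C, Q_p is the
   closure of the rationals (the completion of Q for the p-adic absolute
   value), the algebraic closure of Q_p is the set of elements of C algebraic
   over Q_p, and C is complete with that set dense.  This determines C up to
   isometric isomorphism. *)

Record ultrametricField (R : realType) := UltrametricField {
  uf_field : fieldType;
  uf_abs : uf_field -> R;
  uf_abs_ge0 : forall x, 0 <= uf_abs x;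
  uf_abs_eq0 : forall x, uf_abs x = 0 <-> x = 0;
  uf_absM : forall x y, uf_abs (x * y) = uf_abs x * uf_abs y;
  uf_absD : forall x y, uf_abs (x + y) <= Num.max (uf_abs x) (uf_abs y)
}.

(* A separate head symbol to carry the metric defined by the absolute value. *)
Definition uf_carrier (R : realType) (K : ultrametricField R) : Type :=
  uf_field K.
Coercion uf_carrier : ultrametricField >-> Sortclass.

HB.instance Definition _ (R : realType) (K : ultrametricField R) :=
  GRing.Field.copy (uf_carrier K) (uf_field K).

Section UltrametricTheory.
Variables (R : realType) (K : ultrametricField R).

Definition pabs (z : K) : R := @uf_abs R K z.

Lemma pabs_ge0 (x : K) : 0 <= pabs x. Proof. exact: uf_abs_ge0. Qed.

Lemma pabs0_eq0 (x : K) : pabs x = 0 -> x = 0.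
Proof. exact: (iffLR (uf_abs_eq0 x)). Qed.

Lemma pabs0 : pabs (0 : K) = 0.
Proof. exact: (iffRL (uf_abs_eq0 0)). Qed.

Lemma pabsM (x y : K) : pabs (x * y) = pabs x * pabs y.
Proof. exact: uf_absM. Qed.

Lemma pabsD (x y : K) : pabs (x + y) <= Num.max (pabs x) (pabs y).
Proof. exact: uf_absD. Qed.

Lemma pabs1 : pabs (1 : K) = 1.
Proof.
have n0 : pabs (1 : K) != 0 by apply/eqP => /pabs0_eq0/eqP; rewrite oner_eq0.
by apply: (mulfI n0); rewrite -pabsM !mulr1.
Qed.

Lemma pabsN (x : K) : pabs (- x) = pabs x.
Proof.
suff N1 : pabs (-1 : K) = 1 by rewrite -mulN1r pabsM N1 mul1r.
have : pabs (-1 : K) ^+ 2 == 1 by rewrite expr2 -pabsM mulrNN mulr1 pabs1.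
rewrite sqrf_eq1 => /orP[/eqP //|/eqP h].
by have := pabs_ge0 (-1); rewrite h ler0N1.
Qed.

Let dist (x y : K) : R := pabs (x - y).

Let distxx x : dist x x = 0. Proof. by rewrite /dist subrr pabs0. Qed.

Let dist_pos x y : dist x y = 0 -> x = y.
Proof. by move=> /pabs0_eq0/eqP; rewrite subr_eq0 => /eqP. Qed.

Let dist_sym x y : dist x y = dist y x.
Proof. by rewrite /dist -pabsN opprB. Qed.

Let dist_triangle y x z : dist x z <= dist x y + dist y z.
Proof.
rewrite /dist -(subrKA y x (- z)) (le_trans (pabsD _ _))// ge_max.
by rewrite lerDl lerDr !pabs_ge0.
Qed.

HB.instance Definition _ :=
  isMetric.Build R (uf_carrier K) distxx dist_pos dist_sym dist_triangle.

HB.instance Definition _ := isPointed.Build (uf_carrier K) 0.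

Lemma ball_pabs (x : K) (e : R) : ball x e = [set y | pabs (x - y) < e].
Proof. by rewrite ballEmdist. Qed.

Lemma uf_hausdorff : hausdorff_space K.
Proof. exact: metric_hausdorff. Qed.

Definition padicQ : set K := closure (range (ratr : rat -> K)).

Definition padicQ_alg : set K :=
  [set x | exists P : {poly K}, [/\ P != 0, forall i, padicQ P`_i & root P x]].

Definition padicZ : set K := [set z | padicQ z /\ pabs z <= 1].

End UltrametricTheory.

Record padicComplex (p : nat) (R : realType) := PadicComplex {
  pc_field :> ultrametricField R;
  pc_abs_p : pabs (p%:R : pc_field) = p%:R^-1;
  pc_complete : forall F : set_system pc_field,
    ProperFilter F -> cauchy F -> cvg F;
  pc_alg_closed : forall P : {poly pc_field}, (forall i, padicQ_alg P`_i) ->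
    (1 < size P)%N -> exists2 x, padicQ_alg x & root P x;
  pc_alg_dense : closure (@padicQ_alg R pc_field) = setT
}.

HB.instance Definition _ (p : nat) (R : realType) (C : padicComplex p R) :=
  Uniform_isComplete.Build (uf_carrier C) (@pc_complete p R C).

Section PadicNotions.
Variables (p : nat) (R : realType) (C : padicComplex p R).

Definition gbinom (z : C) (n : nat) : C :=
  (\prod_(i < n) (z - i%:R)) / n`!%:R.

(* q^z for z in Z_p and |1 - q| < 1, by the binomial series of
   (1 + (q - 1))^z; this is the continuous extension to Z_p of n |-> q^n
   (see [qpow_nat] for agreement at the natural numbers). *)
Definition qpow (q z : C) : C :=
  lim (series (fun n => gbinom z n * (q - 1) ^+ n) @ \oo).

(* [z]_q, with the usual limit value [z]_1 = z. *)
Definition qnum (q z : C) : C :=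
  if q == 1 then z else (1 - qpow q z) / (1 - q).

(* [u]_{q^w}: here w u lies in Z_p, but u = w2 x + (w2 / w1) J + Y need not,
   so (q^w)^u is read as q^(w u). *)
Definition qnum_base (q : C) (w : nat) (u : C) : C :=
  (1 - qpow q (w%:R * u)) / (1 - q ^+ w).

(* [w]_q [u]_{q^w}.  When q^w = 1 (q = 1, or q a root of unity whose order
   divides w) the quotient above is undefined, and the product is given by the
   identity [w]_q [u]_{q^w} = [w u]_q, which holds whenever q^w != 1. *)
Definition qnum_mul (q : C) (w : nat) (u : C) : C :=
  if q ^+ w == 1 then qnum q (w%:R * u)
  else qnum q w%:R * qnum_base q w u.

(* Only the values of f at the natural numbers, which lie in Z_p, occur in the
   Riemann sums, so f may be any function on C. *)
Definition fermionic_integral (f : C -> C) : C :=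
  lim ((fun N : nat => \sum_(0 <= y < p ^ N) f y%:R * (-1) ^+ y) @ \oo).

(* The variables y_1, ..., y_r are the successive entries of the tuple, and y_1
   is integrated first. *)
Fixpoint fermionic_integraln (r : nat) : (r.-tuple C -> C) -> C :=
  match r with
  | 0 => fun g => g [tuple]
  | r'.+1 => fun g => fermionic_integraln
      (fun ys : r'.-tuple C => fermionic_integral (fun y => g [tuple of y :: ys]))
  end.

(* A formal power series in t is represented by its sequence of coefficients;
   this is the integral of e^(g t). *)
Definition fermionic_exp (r : nat) (g : r.-tuple C -> C) (n : nat) : C :=
  fermionic_integraln (fun ys => g ys ^+ n) / n`!%:R.

Lemma natr_padic_neq0 (n : nat) : prime p -> (0 < n)%N -> (n%:R : C) != 0.
Proof.
move=> p_pr n_gt0; have p_gt1 := prime_gt1 p_pr.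
have p_neq0 : (p%:R : C) != 0.
  apply/eqP => p0; have := pc_abs_p C; rewrite p0 pabs0 => /eqP.
  by rewrite eq_sym invr_eq0 pnatr_eq0 -leqn0 leqNgt ltnW.
have [m npm ->] := pfactor_coprime p_pr n_gt0.
rewrite natrM natrX mulf_neq0 ?expf_neq0//; apply/eqP => m0.
have nat_le1 k : pabs (k%:R : C) <= 1.
  elim: k => [|k IH]; first by rewrite pabs0 ler01.
  by rewrite -natr1 (le_trans (pabsD _ _))// ge_max IH pabs1 lexx.
have [u v /= uv _] := egcdnP m (prime_gt0 p_pr).
move: uv; rewrite (eqP npm) => /(congr1 (fun k => k%:R : C)) /eqP.
rewrite natrD !natrM m0 mulr0 add0r => /eqP /(congr1 (@pabs R C)).
rewrite pabsM pabs1 pc_abs_p => h.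
have : (1 : R) < p%:R by rewrite ltr1n.
rewrite ltNge => /negP; apply.
have p0 : (p%:R : R) != 0 by rewrite pnatr_eq0 -lt0n ltnW.
have -> : (p%:R : R) = pabs (u%:R : C) by rewrite -[RHS](divfK p0) h mul1r.
exact: nat_le1.
Qed.

Lemma gbinom_nat (n k : nat) : prime p -> gbinom n%:R k = 'C(n, k)%:R.
Proof.
move=> p_pr; rewrite /gbinom.
have k0 : (k`!%:R : C) != 0 by rewrite natr_padic_neq0 ?fact_gt0.
apply: (mulIf k0); rewrite mulfVK// -natrM bin_ffact.
have [nk|kn] := ltnP n k.
  by rewrite ffact_small// (bigD1 (Ordinal nk))//= subrr mul0r.
rewrite ffact_prod natr_prod; apply: eq_bigr => i _.
by rewrite natrB// ltnW// (leq_trans (ltn_ord i)).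
Qed.

Lemma qpow_nat (q : C) (n : nat) : prime p -> qpow q n%:R = q ^+ n.
Proof.
move=> p_pr; rewrite /qpow; apply: cvg_lim; first exact: uf_hausdorff.
apply: cvg_near_cst; near=> N.
have nN : (n < N)%N by near: N; exact: nbhs_infty_gt.
rewrite /series /= (big_cat_nat _ (n := n.+1))//= big_mkord.
rewrite [X in _ + X]big_nat_cond [X in _ + X]big1 ?addr0; last first.
  by move=> k /andP[/andP[nk _] _]; rewrite gbinom_nat// bin_small// mul0r.
rewrite -[in RHS](subrK 1 q) [in RHS]addrC exprDn; apply: eq_bigr => i _.
by rewrite expr1n mul1r gbinom_nat// mulr_natl.
Unshelve. all: by end_near. Qed.

End PadicNotions.

(* Main.v *)
(* Since [w]_q [u]_{q^w} = [w u]_q, both sides depend only on the function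
   h(m) = [w1 w2 x + m]_q ^ n of a natural number m, which is p-adically
   uniformly continuous.  Let T_w h (m) be the fermionic integral of h(m + w y)
   and A_{v,s} h (m) the sum over i < v of (-1)^i h(m + s i).  The left-hand side
   is (A_{w1,w2}^r T_{w1}^r h)(0) / n!, and as A and T commute it suffices that
   A_{w1,w2} T_{w1} = A_{w2,w1} T_{w2}.  For odd w the Riemann sums over w p^N
   terms have the same limit as those over p^N terms (for p = 2 both tend to 0),
   and summing over w2 p^N terms in T_{w1} makes the double sum symmetric. *)
Require Import Defs.
From mathcomp Require Import all_boot all_order all_algebra.
From mathcomp Require Import all_classical all_reals all_analysis.
Import Order.TTheory GRing.Theory Num.Theory.
Local Open Scope ring_scope.

Set Implicit Arguments.
Unset Strict Implicit.
Unset Printing Implicit Defensive.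

(** * Estimates and limits of sequences for an ultrametric absolute value *)

Section Ultrametric.
Variables (R : realType) (K : ultrametricField R).
Implicit Types (x y z : K) (u v : nat -> K) (e : R).

Lemma pabsD_le x y e : pabs x <= e -> pabs y <= e -> pabs (x + y) <= e.
Proof. by move=> xe ye; rewrite (le_trans (pabsD _ _))// ge_max xe. Qed.

Lemma pabsBC x y : pabs (x - y) = pabs (y - x).
Proof. by rewrite -pabsN opprB. Qed.

Lemma pabsB_trans y x z e :
  pabs (x - y) <= e -> pabs (y - z) <= e -> pabs (x - z) <= e.
Proof. by move=> xy yz; rewrite -(subrKA y); exact: pabsD_le. Qed.

Lemma pabs_sum_le (I : eqType) (s : seq I) (F : I -> K) e : 0 <= e ->
  (forall i, i \in s -> pabs (F i) <= e) -> pabs (\sum_(i <- s) F i) <= e.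
Proof.
move=> e0 Fe; rewrite big_seq.
apply: (big_ind (fun x => pabs x <= e)) => [|x y xe ye|i]; last exact: Fe.
  by rewrite pabs0.
exact: pabsD_le.
Qed.

Lemma pabsX x n : pabs (x ^+ n) = pabs x ^+ n.
Proof. by elim: n => [|n IH]; rewrite ?expr0 ?pabs1// !exprS pabsM IH. Qed.

Lemma pabsV x : pabs x^-1 = (pabs x)^-1.
Proof.
have [->|x0] := eqVneq x 0; first by rewrite invr0 pabs0 invr0.
have ax0 : pabs x != 0 by apply: contra x0 => /eqP/pabs0_eq0/eqP.
by apply: (mulfI ax0); rewrite -pabsM !mulfV// pabs1.
Qed.

Lemma pabs_sign n : pabs ((-1) ^+ n : K) = 1.
Proof. by rewrite pabsX pabsN pabs1 expr1n. Qed.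

Lemma pabs_nat_le1 n : pabs (n%:R : K) <= 1.
Proof.
elim: n => [|n IH]; first by rewrite pabs0 ler01.
by rewrite -natr1 pabsD_le// pabs1.
Qed.

(** The factors are exchanged one at a time; each exchange costs at most [e] because the remaining
    factors have absolute value at most 1. *)
Lemma pabs_prodB_le (I : Type) (s : seq I) (F G : I -> K) e : 0 <= e ->
  (forall i, pabs (F i) <= 1) -> (forall i, pabs (G i) <= 1) ->
  (forall i, pabs (F i - G i) <= e) ->
  pabs (\prod_(i <- s) F i - \prod_(i <- s) G i) <= e.
Proof.
move=> e0 F1 G1 FG.
(* The induction also carries the bound on the product of the [G i], which multiplies the difference
   [F i - G i]. *)
suff [] : pabs (\prod_(i <- s) F i - \prod_(i <- s) G i) <= e /\
          pabs (\prod_(i <- s) G i) <= 1 by [].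
elim: s => [|i s [IHe IH1]]; first by rewrite !big_nil subrr pabs0 pabs1.
rewrite !big_cons; split; last by rewrite pabsM mulr_ile1 ?pabs_ge0.
apply: (@pabsB_trans (F i * \prod_(j <- s) G j)).
  by rewrite -mulrBr pabsM -[e]mul1r ler_pM ?pabs_ge0.
by rewrite -mulrBl pabsM -[e]mulr1 ler_pM ?pabs_ge0.
Qed.

Lemma cvg_pabsP u x : (u @ \oo --> x)%classic <->
  forall e, 0 < e -> exists M, forall N, (M <= N)%N -> pabs (u N - x) <= e.
Proof.
split=> [/cvg_ballP ux e e0|ux].
  have [M _ MP] := ux e e0; exists M => N MN; have := MP N MN.
  by rewrite /= ball_pabs/= pabsBC => /ltW.
apply/cvg_ballP => e e0; have e20 : 0 < e / 2 by rewrite divr_gt0.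
have [M MP] := ux _ e20; exists M => // N /= MN.
rewrite ball_pabs/= pabsBC (le_lt_trans (MP _ MN))//.
by rewrite ltr_pdivrMr// ltr_pMr// ltr1n.
Qed.

Lemma pcvg_lim u x : (u @ \oo --> x)%classic -> (lim (u @ \oo))%classic = x.
Proof. by move=> ux; apply: cvg_lim => //; exact: uf_hausdorff. Qed.

Lemma pcvgD u v x y : (u @ \oo --> x)%classic -> (v @ \oo --> y)%classic ->
  ((fun N => u N + v N) @ \oo --> x + y)%classic.
Proof.
move=> /cvg_pabsP ux /cvg_pabsP vy; apply/cvg_pabsP => e e0.
have [M MP] := ux e e0; have [M' MP'] := vy e e0.
exists (maxn M M') => N; rewrite geq_max => /andP[MN MN'].
by rewrite opprD addrACA pabsD_le ?MP ?MP'.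
Qed.

Lemma pcvgMl a u x : (u @ \oo --> x)%classic ->
  ((fun N => a * u N) @ \oo --> a * x)%classic.
Proof.
move=> /cvg_pabsP ux; apply/cvg_pabsP => e e0.
have a1 : 0 < 1 + pabs a by rewrite ltr_pwDl ?pabs_ge0.
have [M MP] := ux _ (divr_gt0 e0 a1); exists M => N /MP uN.
rewrite -mulrBr pabsM -[e](divfK (lt0r_neq0 a1)) mulrC ler_pM ?pabs_ge0//.
by rewrite lerDr.
Qed.

Lemma pcvg_sum (I : Type) (s : seq I) (U : I -> nat -> K) (X : I -> K) :
  (forall i, (U i @ \oo --> X i)%classic) ->
  ((fun N => \sum_(i <- s) U i N) @ \oo --> \sum_(i <- s) X i)%classic.
Proof.
move=> UX; elim: s => [|i s IH].
  by apply/cvg_pabsP => e e0; exists 0%N => N _; rewrite !big_nil subrr pabs0 ltW.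
under eq_fun do rewrite big_cons.
by rewrite big_cons; exact: pcvgD.
Qed.

Lemma pabs_lim_le u x e : (u @ \oo --> x)%classic -> 0 < e ->
  (forall N, pabs (u N) <= e) -> pabs x <= e.
Proof.
move=> /cvg_pabsP ux e0 ue; have [M /(_ M (leqnn M)) MP] := ux e e0.
by rewrite -(subKr (u M) x) pabsD_le// pabsN.
Qed.

Lemma pcvg_near u v x : (u @ \oo --> x)%classic ->
  (forall e, 0 < e -> exists M, forall N, (M <= N)%N -> pabs (v N - u N) <= e) ->
  (v @ \oo --> x)%classic.
Proof.
move=> /cvg_pabsP ux vu; apply/cvg_pabsP => e e0.
have [M MP] := ux e e0; have [M' MP'] := vu e e0.
exists (maxn M M') => N; rewrite geq_max => /andP[MN MN'].
by apply: (@pabsB_trans (u N)); rewrite ?MP ?MP'.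
Qed.

End Ultrametric.

(** * Convergence of alternating sums over $p^N$ and $w p^N$ terms *)

Section Padic.
Variables (p : nat) (R : realType) (C : padicComplex p R).
Hypothesis p_prime : prime p.
Implicit Types (f h : nat -> C) (u : nat -> C) (e : R) (m w N : nat).

(** By the ultrametric inequality, small consecutive differences already make a sequence Cauchy;
    completeness of [C] does the rest. *)
Lemma pcvg_step u :
  (forall e, 0 < e -> exists M, forall N, (M <= N)%N ->
     pabs (u N.+1 - u N) <= e) ->
  (u @ \oo --> lim (u @ \oo))%classic.
Proof.
move=> step; apply: pc_complete; apply: cauchy_exP => e e0.
have e20 : 0 < e / 2 by rewrite divr_gt0.
have [M MP] := step _ e20; exists (u M); exists M => // N /= MN.
rewrite ball_pabs/= pabsBC (@le_lt_trans _ _ (e / 2))//; last first.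
  by rewrite ltr_pdivrMr// ltr_pMr// ltr1n.
rewrite -(subnKC MN); elim: (N - M)%N => [|k IH].
  by rewrite addn0 subrr pabs0 ltW.
by rewrite addnS (pabsB_trans _ IH)// MP// leq_addr.
Qed.

Lemma pabs_p_lt1 : pabs (p%:R : C) < 1.
Proof. by rewrite pc_abs_p invf_lt1 ?ltr1n ?ltr0n ?prime_gt1 ?prime_gt0. Qed.

Lemma expr_small (a c e : R) : 0 <= a < 1 -> 0 < e ->
  exists M, forall N, (M <= N)%N -> a ^+ N * c <= e.
Proof.
move=> /andP[a0 a1] e0.
have c1 : 0 < 1 + `|c| by rewrite ltr_pwDl.
have a_lt1 : `|a| < 1 by rewrite ger0_norm.
have /cvgrPdist_le/(_ _ (divr_gt0 e0 c1))[M _ MP] := cvg_expr a_lt1.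
exists M => N /MP /=; rewrite sub0r normrN ger0_norm ?exprn_ge0// ler_pdivlMr//.
apply: le_trans; rewrite ler_wpM2l ?exprn_ge0// (le_trans (ler_norm _))//.
by rewrite lerDr.
Qed.

(** Uniform continuity for the $p$-adic topology on the naturals. Of two naturals congruent modulo
    $p^N$, the larger one is written as [a + p ^ N * b]. *)
Definition padic_uniform f := forall e, 0 < e -> exists M, forall N a b,
  (M <= N)%N -> pabs (f (a + p ^ N * b)%N - f a) <= e.

Lemma padic_uniform_affine f m w :
  padic_uniform f -> padic_uniform (fun y => f (m + w * y)%N).
Proof.
move=> fu e /fu[M MP]; exists M => N a b MN.
by rewrite mulnDr addnA mulnCA MP.
Qed.

Definition altsum f n : C := \sum_(0 <= y < n) f y * (-1) ^+ y.

(** Cutting the range into [v] blocks of length $p^N$, the [i]-th block is a shift of the first by a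
    multiple of $p^N$: its values change by at most [e], and a sign $(-1)^{i p^N}$ comes out. The
    rank [M] does not depend on [v]. *)
Lemma altsum_block f e : padic_uniform f -> 0 < e ->
  exists M, forall N v, (M <= N)%N ->
    pabs (altsum f (v * p ^ N)
          - (\sum_(0 <= i < v) (-1) ^+ (i * p ^ N)) * altsum f (p ^ N)) <= e.
Proof.
move=> fu e0; have [M MP] := fu e e0; exists M => N v MN.
elim: v => [|v IH].
  by rewrite mul0n {1}/altsum big_geq// [X in X * _]big_geq// mul0r subrr pabs0 ltW.
rewrite [X in X * _]big_nat_recr//= mulrDl {1}/altsum mulSn addnC.
rewrite (big_cat_nat _ (n := (v * p ^ N)%N)) ?leq_addr//=.
rewrite opprD addrACA pabsD_le//.
rewrite -{1}[(v * p ^ N)%N]add0n big_addn addnC addnK.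
rewrite /altsum mulr_sumr -sumrB; apply: pabs_sum_le => [|i _]; first exact: ltW.
rewrite exprD [X in _ - X]mulrC -mulrA -mulrBl.
rewrite !pabsM !pabs_sign !mulr1 [(v * _)%N]mulnC.
exact: MP.
Qed.

Lemma sum_sign_even v n : ~~ odd n ->
  \sum_(0 <= i < v) (-1) ^+ (i * n) = v%:R :> C.
Proof.
move=> n_even; rewrite big_mkord (eq_bigr (fun=> 1)) => [|i _].
  by rewrite sumr_const card_ord.
by rewrite -signr_odd oddM (negbTE n_even) andbF.
Qed.

Lemma sum_sign_odd v n : odd v -> odd n ->
  \sum_(0 <= i < v) (-1) ^+ (i * n) = 1 :> C.
Proof.
move=> v_odd n_odd.
under eq_bigr do rewrite -signr_odd oddM n_odd andbT signr_odd.
suff -> : \sum_(0 <= i < v) (-1) ^+ i = (odd v)%:R :> C by rewrite v_odd.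
elim: v {v_odd} => [|v IH]; first by rewrite big_geq.
rewrite big_nat_recr//= IH -signr_odd; case: (odd v) => /=.
  by rewrite subrr.
by rewrite add0r.
Qed.

(** For even block length all block signs are 1, so up to [e] each sum is $2$ times the preceding
    one, and $|2|_2 < 1$. *)
Lemma altsum_pow2_cvg0 f : p = 2%N -> padic_uniform f ->
  ((fun N => altsum f (p ^ N)) @ \oo --> (0 : C))%classic.
Proof.
move=> p2 fu; apply/cvg_pabsP => e e0.
have [M MP] := altsum_block fu e0.
pose a := pabs (p%:R : C).
have a01 : 0 <= a < 1 by rewrite pabs_ge0 pabs_p_lt1.
(* Starting at [M.+1] rather than [M] makes the exponent positive, hence the block length even. *)
have bound k : pabs (altsum f (p ^ (M.+1 + k))) <=
    Num.max (a ^+ k * pabs (altsum f (p ^ M.+1))) e.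
  elim: k => [|k IH]; first by rewrite addn0 expr0 mul1r le_max lexx.
  have := MP (M.+1 + k)%N p; rewrite -expnS -addnS => /(_ _).
  rewrite sum_sign_even; last by rewrite p2 oddX.
  move=> /(_ (leq_trans (leqnSn M) (leq_addr _ _))) H.
  rewrite -(subrK (p%:R * altsum f (p ^ (M.+1 + k))) (altsum _ _)).
  rewrite pabsD_le//; first by rewrite le_max H orbT.
  rewrite pabsM -/a; case/andP: a01 => a0 /ltW a1.
  rewrite (le_trans (ler_wpM2l a0 IH))// maxr_pMr// ge_max !le_max.
  by rewrite mulrA -exprS lexx/= [X in _ || X](_ : _ = true) ?orbT// ler_piMl// ltW.
have [M' MP'] := expr_small (pabs (altsum f (p ^ M.+1))) a01 e0.
exists (M.+1 + M')%N => N MN; rewrite subr0.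
have MN' : (M.+1 <= N)%N by apply: leq_trans MN; exact: leq_addr.
rewrite -(subnKC MN') (le_trans (bound _))// ge_max lexx andbT MP'//.
by rewrite leq_subRL.
Qed.

(** One limit serves all odd [w]. For odd [p] the block signs add up to 1, so the sums over $w p^N$
    and $p^N$ terms become close; for [p = 2] they are close to [w] times sums that tend to 0. *)
Lemma altsum_cvg f : padic_uniform f ->
  exists l : C, forall w, odd w ->
    ((fun N => altsum f (w * p ^ N)) @ \oo --> l)%classic.
Proof.
move=> fu; have [p2|p_odd] := even_prime p_prime.
  exists 0 => w w_odd; apply: pcvg_near.
    rewrite -(mulr0 w%:R); apply: pcvgMl; exact: (altsum_pow2_cvg0 p2 fu).
  move=> e e0; have [M MP] := altsum_block fu e0.
  exists M.+1 => -[//|N] MN; have := MP N.+1 w (ltnW MN).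
  by rewrite sum_sign_even// p2 oddX.
pose l : C := (lim ((fun N => altsum f (p ^ N)) @ \oo))%classic.
exists l => w w_odd.
have block v e : odd v -> 0 < e -> exists M, forall N, (M <= N)%N ->
    pabs (altsum f (v * p ^ N) - altsum f (p ^ N)) <= e.
  move=> v_odd e0; have [M MP] := altsum_block fu e0.
  exists M => N MN; have := MP N v MN.
  by rewrite sum_sign_odd ?oddX ?p_odd ?orbT// mul1r.
apply: (@pcvg_near _ _ (fun N => altsum f (p ^ N))) => [|e e0]; last exact: block.
(* With [v = p], the block estimate compares consecutive terms of the sequence. *)
apply: pcvg_step => e e0; have [M MP] := block p e p_odd e0.
by exists M => N MN; rewrite expnS MP.
Qed.

(** * The operators $T_w$ ([fermi w]) and $A_{v,s}$ ([twist v s]), their commutation and their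
    symmetry *)

Definition fermi w h m : C :=
  (lim ((fun N => altsum (fun y => h (m + w * y)%N) (p ^ N)) @ \oo))%classic.

Lemma fermi_cvg_mul w h m v : padic_uniform h -> odd v ->
  ((fun N => altsum (fun y => h (m + w * y)%N) (v * p ^ N)) @ \oo
    --> fermi w h m)%classic.
Proof.
move=> hu v_odd; have [l lP] := altsum_cvg (padic_uniform_affine m w hu).
suff -> : fermi w h m = l by exact: lP.
apply: pcvg_lim; have := lP 1%N isT.
by under eq_fun do rewrite mul1n.
Qed.

Lemma fermi_cvg w h m : padic_uniform h ->
  ((fun N => altsum (fun y => h (m + w * y)%N) (p ^ N)) @ \oo
    --> fermi w h m)%classic.
Proof.
move=> hu; have := @fermi_cvg_mul w h m 1 hu isT.
by under eq_fun do rewrite mul1n.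
Qed.

(** The rank [M] chosen for [h] works unchanged: the ultrametric inequality bounds the difference of
    two Riemann sums termwise, whatever their length, and the bound passes to the limit. *)
Lemma fermi_uniform w h : padic_uniform h -> padic_uniform (fermi w h).
Proof.
move=> hu e e0; have [M MP] := hu e e0; exists M => N a b MN.
pose S x N' := altsum (fun y => h (x + w * y)%N) (p ^ N').
have S_cvg x : (S x @ \oo --> fermi w h x)%classic by exact: fermi_cvg.
rewrite -mulN1r.
have SD := pcvgD (S_cvg (a + p ^ N * b)%N) (@pcvgMl _ _ (-1) _ _ (S_cvg a)).
apply: (pabs_lim_le SD e0) => N'.
rewrite mulN1r /S /altsum -sumrB; apply: pabs_sum_le => [|y _]; first exact: ltW.
by rewrite -mulrBl pabsM pabs_sign mulr1 addnAC MP.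
Qed.

Definition twist v s h m : C := \sum_(0 <= i < v) (-1) ^+ i * h (m + s * i)%N.

Lemma twist_uniform v s h : padic_uniform h -> padic_uniform (twist v s h).
Proof.
move=> hu e e0; have [M MP] := hu e e0; exists M => N a b MN.
rewrite /twist -sumrB; apply: pabs_sum_le => [|i _]; first exact: ltW.
by rewrite -mulrBr pabsM pabs_sign mul1r addnAC MP.
Qed.

Lemma twist_fermi v s w h : padic_uniform h ->
  twist v s (fermi w h) = fermi w (twist v s h).
Proof.
move=> hu; apply/funext => m; apply/esym/pcvg_lim.
pose S i N := altsum (fun y => h (m + s * i + w * y)%N) (p ^ N).
have S_cvg i : ((fun N => (-1) ^+ i * S i N) @ \oo
    --> (-1) ^+ i * fermi w h (m + s * i))%classic.
  by apply: pcvgMl; exact: fermi_cvg.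
rewrite (_ : (fun N => _) = fun N => \sum_(0 <= i < v) (-1) ^+ i * S i N).
  exact: pcvg_sum.
apply/funext => N; rewrite /S /altsum /twist; under [RHS]eq_bigr do rewrite mulr_sumr.
rewrite [RHS]exchange_big/=; apply: eq_bigr => y _; rewrite mulr_suml.
by apply: eq_bigr => i _; rewrite mulrA addnAC.
Qed.

(* Running over [w2 * p ^ N] terms and writing y = j + w2 k turns the sum over
   i < w1 of the N-th Riemann sums into a sum over i < w1, j < w2 and k < p ^ N
   of values at m + w2 i + w1 j + w1 w2 k, which is symmetric in w1 and w2. *)
Lemma twist_fermi_sym w1 w2 h : odd w1 -> odd w2 -> padic_uniform h ->
  twist w1 w2 (fermi w1 h) = twist w2 w1 (fermi w2 h).
Proof.
move=> w1_odd w2_odd hu; apply/funext => m.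
pose D v w N : C := \sum_(0 <= i < v) \sum_(0 <= k < p ^ N) \sum_(0 <= j < w)
  (-1) ^+ (i + j + k) * h (m + w * i + v * j + v * w * k)%N.
have D_cvg v w : odd v -> odd w ->
    (D v w @ \oo --> twist v w (fermi v h) m)%classic.
  move=> v_odd w_odd.
  pose S i N := altsum (fun y => h (m + w * i + v * y)%N) (w * p ^ N).
  have S_cvg i : ((fun N => (-1) ^+ i * S i N) @ \oo
      --> (-1) ^+ i * fermi v h (m + w * i))%classic.
    by apply: pcvgMl; exact: fermi_cvg_mul.
  rewrite (_ : D v w = fun N => \sum_(0 <= i < v) (-1) ^+ i * S i N).
    exact: pcvg_sum.
  apply/funext => N; rewrite /D; apply: eq_bigr => i _; rewrite /S /altsum.
  rewrite [(w * p ^ N)%N]mulnC big_nat_mul mulr_sumr.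
  apply: eq_bigr => k _; rewrite -{1}[(k * w)%N]add0n big_addn mulSn addnK.
  rewrite mulr_sumr; apply: eq_bigr => j _.
  rewrite [RHS]mulrCA mulrC -!exprD; congr (h _ * _).
    by rewrite mulnDr [(k * w)%N]mulnC mulnA !addnA.
  (* Since [w] is odd, [j + k * w] has the parity of [j + k], so the sign is symmetric as well. *)
  rewrite -signr_odd -[RHS]signr_odd !oddD oddM w_odd andbT.
  by rewrite addbA.
rewrite -(pcvg_lim (D_cvg _ _ w1_odd w2_odd)).
rewrite -(pcvg_lim (D_cvg _ _ w2_odd w1_odd)).
suff -> : D w1 w2 = D w2 w1 by []; apply/funext => N; rewrite /D.
under eq_bigr do rewrite exchange_big/=.
rewrite exchange_big/=; apply: eq_bigr => j _.
rewrite exchange_big/=; apply: eq_bigr => k _.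
apply: eq_bigr => i _.
rewrite [(i + j)%N]addnC [(w1 * w2)%N]mulnC.
by rewrite [(m + w2 * i + _)%N]addnAC.
Qed.

Lemma iter_twist_uniform r v s h :
  padic_uniform h -> padic_uniform (iter r (twist v s) h).
Proof. by move=> hu; elim: r => //= r IH; exact: twist_uniform. Qed.

Lemma iter_fermi_uniform r w h :
  padic_uniform h -> padic_uniform (iter r (fermi w) h).
Proof. by move=> hu; elim: r => //= r IH; exact: fermi_uniform. Qed.

(** Commuting operators satisfy $A^r T^r = (AT)^r$, which reduces the [r]-fold symmetry to the case
    of one variable. *)
Lemma iter_twist_fermi r v s w h : padic_uniform h ->
  iter r (twist v s) (iter r (fermi w) h) = iter r (twist v s \o fermi w) h.
Proof.
have comm k g : padic_uniform g ->
    iter k (twist v s) (fermi w g) = fermi w (iter k (twist v s) g).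
  move=> gu; elim: k => //= k ->; apply: twist_fermi.
  exact: iter_twist_uniform.
move=> hu; elim: r => //= r <-; rewrite comm//.
exact: iter_fermi_uniform.
Qed.

Lemma iter_twist_fermi_sym r w1 w2 h : odd w1 -> odd w2 -> padic_uniform h ->
  iter r (twist w1 w2) (iter r (fermi w1) h) =
  iter r (twist w2 w1) (iter r (fermi w2) h).
Proof.
move=> w1_odd w2_odd hu; rewrite !iter_twist_fermi//.
(* Uniformity of the common iterate is carried along, so that the one-variable symmetry applies to
   it. *)
suff [] : iter r (twist w1 w2 \o fermi w1) h = iter r (twist w2 w1 \o fermi w2) h
  /\ padic_uniform (iter r (twist w2 w1 \o fermi w2) h) by [].
elim: r => //= r [-> IHu]; split; first exact: twist_fermi_sym.
by apply: twist_uniform; exact: fermi_uniform.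
Qed.

(** * Multiple integrals and multiple sums as iterates of [fermi] and [twist] *)

Lemma fermionic_integraln_iter r (g : r.-tuple C -> C) w h m :
  (forall ys : r.-tuple nat,
     g (map_tuple (fun y => y%:R) ys) = h (m + w * \sum_(y <- ys) y)%N) ->
  fermionic_integraln g = iter r (fermi w) h m.
Proof.
elim: r g h => [|r IH] g h gh.
  have := gh [tuple]; rewrite big_nil muln0 addn0 /= => <-.
  by congr g; exact: val_inj.
(* The head variable is integrated first, so it matches the innermost [fermi w]; the other variables
   only move the base point. *)
rewrite iterSr; apply: IH => ys; congr (lim (_ @ \oo))%classic.
apply/funext => N; apply: eq_bigr => y _; congr (_ * _).
have := gh [tuple of y :: ys].
rewrite big_cons mulnDr [(w * y + _)%N]addnC addnA => <-.
by congr g; exact: val_inj.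
Qed.

Lemma sum_ffun_twist r v s h m :
  \sum_(j : {ffun 'I_r -> 'I_v})
    (-1) ^+ (\sum_(i < r) j i)%N * h (m + s * \sum_(i < r) j i)%N =
  iter r (twist v s) h m.
Proof.
elim: r m => [|r IH] m.
  have j0 (j : {ffun 'I_0 -> 'I_v}) : (\sum_(i < 0) j i)%N = 0%N.
    by rewrite big_ord0.
  under eq_bigr do rewrite j0 muln0 addn0 mul1r.
  by rewrite sumr_const card_ffun !card_ord expn0.
rewrite iterS /twist big_mkord.
under [RHS]eq_bigr do rewrite -IH mulr_sumr.
rewrite pair_big/=.
(* [consf] and [unconsf] are inverse bijections separating the value at [ord0], which is the index
   of the outermost [twist]. *)
pose consf (t : 'I_v * {ffun 'I_r -> 'I_v}) : {ffun 'I_r.+1 -> 'I_v} :=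
  [ffun k => oapp t.2 t.1 (unlift ord0 k)].
pose unconsf (j : {ffun 'I_r.+1 -> 'I_v}) :=
  (j ord0, [ffun k => j (lift ord0 k)]).
rewrite (reindex consf); last first.
  exists unconsf => [[i j] _|j _]; rewrite /consf /unconsf.
    rewrite ffunE unlift_none/=; congr (_, _).
    by apply/ffunP => k; rewrite !ffunE liftK.
  apply/ffunP => k; rewrite !ffunE/=.
  by case: unliftP => [k' ->|->] //=; rewrite ffunE.
apply: eq_bigr => -[i j] _.
have -> : (\sum_(k < r.+1) consf (i, j) k = i + \sum_(k < r) j k)%N.
  rewrite big_ord_recl ffunE unlift_none/=; congr (_ + _)%N.
  by apply: eq_bigr => k _; rewrite ffunE liftK.
by rewrite exprD mulrA mulnDr addnA.
Qed.

(** * Points in the closure of the naturals, and continuity of $q$-numbers there *)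

Definition near_nat (z : C) :=
  forall e, 0 < e -> exists k, pabs (z - k%:R) <= e.

Lemma near_nat_affine (z : C) m w : near_nat z -> near_nat (w%:R * z + m%:R).
Proof.
move=> zn e /zn[k zk]; exists (w * k + m)%N.
rewrite natrD natrM opprD addrACA subrr addr0 -mulrBr pabsM.
by rewrite -[e]mul1r ler_pM ?pabs_ge0 ?pabs_nat_le1.
Qed.

Lemma near_nat_le1 (z : C) : near_nat z -> pabs z <= 1.
Proof.
by move=> /(_ 1 ltr01)[k zk]; rewrite -(subrK k%:R z) pabsD_le// pabs_nat_le1.
Qed.

Lemma pabs_gt0 (z : C) : z != 0 -> 0 < pabs z.
Proof.
by move=> z0; rewrite lt0r pabs_ge0 andbT; apply: contra z0 => /eqP/pabs0_eq0/eqP.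
Qed.

Lemma pabs_p_expn M b : pabs ((p ^ M * b)%:R : C) <= pabs (p%:R : C) ^+ M.
Proof.
by rewrite natrM natrX pabsM pabsX ler_piMr ?exprn_ge0 ?pabs_ge0 ?pabs_nat_le1.
Qed.

Lemma pabs_p_expn_small e : 0 < e -> exists M, forall N, (M <= N)%N ->
  forall b, pabs ((p ^ N * b)%:R : C) <= e.
Proof.
move=> e0; have a01 : 0 <= pabs (p%:R : C) < 1 by rewrite pabs_ge0 pabs_p_lt1.
have [M MP] := expr_small 1 a01 e0; exists M => N /MP; rewrite mulr1 => pN b.
exact: le_trans (pabs_p_expn _ _) pN.
Qed.

Lemma pabs_fact_gt0 k : 0 < pabs (k`!%:R : C).
Proof. by rewrite pabs_gt0// natr_padic_neq0// fact_gt0. Qed.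

(** The numerators are compared factor by factor; the factor $|k!|$ in the hypothesis compensates
    for the division by $k!$. *)
Lemma gbinomB_le (z z' : C) k e : pabs z <= 1 -> pabs z' <= 1 -> 0 <= e ->
  pabs (z - z') <= e * pabs (k`!%:R : C) -> pabs (gbinom z k - gbinom z' k) <= e.
Proof.
move=> z1 z'1 e0 zz'; rewrite /gbinom -mulrBl pabsM pabsV.
rewrite ler_pdivrMr ?pabs_fact_gt0//.
have nat_le1 (y : C) (i : 'I_k) : pabs y <= 1 -> pabs (y - i%:R) <= 1.
  by move=> y1; rewrite pabsD_le// pabsN pabs_nat_le1.
apply: pabs_prodB_le => [|i|i|i]; rewrite ?nat_le1//.
  by rewrite mulr_ge0 ?pabs_ge0.
by rewrite opprB addrA subrK.
Qed.

(** At a natural number the binomial is an integer, and a natural within $|k!|$ of [z] changes its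
    value by at most 1. *)
Lemma gbinom_le1 (z : C) k : near_nat z -> pabs (gbinom z k) <= 1.
Proof.
move=> zn; have [n zn_fact] := zn _ (pabs_fact_gt0 k).
rewrite -(subrK (gbinom n%:R k) (gbinom z k)) pabsD_le//.
  by apply: gbinomB_le; rewrite ?mul1r ?pabs_nat_le1// near_nat_le1.
by rewrite gbinom_nat// pabs_nat_le1.
Qed.

Section Qpow.
Variable q : C.
Hypothesis q_lt1 : pabs (1 - q) < 1.

Let a01 : 0 <= pabs (q - 1) < 1.
Proof. by rewrite pabs_ge0 pabsBC. Qed.

Lemma qpow_term_le (z : C) n : near_nat z ->
  pabs (gbinom z n * (q - 1) ^+ n) <= pabs (q - 1) ^+ n.
Proof.
by move=> zn; rewrite pabsM pabsX ler_piMl ?exprn_ge0 ?pabs_ge0 ?gbinom_le1.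
Qed.

Lemma qpow_cvg (z : C) : near_nat z ->
  (series (fun n => gbinom z n * (q - 1) ^+ n) @ \oo --> qpow q z)%classic.
Proof.
move=> zn; apply: pcvg_step => e e0.
have [M MP] := expr_small 1 a01 e0; exists M => N /MP; rewrite mulr1 => aN.
rewrite /series/= big_nat_recr//= addrAC subrr add0r.
exact: le_trans (qpow_term_le _ zn) aN.
Qed.

Lemma qpow_le1 (z : C) : near_nat z -> pabs (qpow q z) <= 1.
Proof.
move=> zn; apply: (pabs_lim_le (qpow_cvg zn)) => // N.
apply: pabs_sum_le => // n _; apply: le_trans (qpow_term_le _ zn) _.
by case/andP: a01 => a0 /ltW a1; rewrite exprn_ile1.
Qed.

(** The terms are dominated by $|q-1|^n$ independently of [z], so one truncation rank serves all
    [z]. *)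
Lemma qpow_tail e : 0 < e -> exists M, forall z : C, near_nat z ->
  pabs (qpow q z - \sum_(0 <= n < M) gbinom z n * (q - 1) ^+ n) <= e.
Proof.
move=> e0; have [M MP] := expr_small 1 a01 e0; exists M => z zn.
have [M' MP'] := (cvg_pabsP _ _).1 (qpow_cvg zn) e e0.
have := MP' (M + M')%N (leq_addl _ _); rewrite pabsBC => /pabsB_trans -> //.
rewrite /series/= (big_cat_nat _ (n := M)) ?leq_addr//= addrAC subrr add0r.
apply: pabs_sum_le => [|n]; first exact: ltW.
rewrite mem_index_iota => /andP[/MP]; rewrite mulr1 => an _.
exact: le_trans (qpow_term_le _ zn) an.
Qed.

Lemma qpow_uniform (z : C) : near_nat z ->
  padic_uniform (fun m => qpow q (z + m%:R)).
Proof.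
move=> zn e e0; have zmn m : near_nat (z + m%:R).
  by rewrite -[z]mul1r; exact: (@near_nat_affine z m 1).
have [M MP] := qpow_tail e0.
(* Only binomials with [n < M] remain; as $n!$ divides $M!$, the tolerance $e|M!|$ suits them
   all. *)
have [M' MP'] := pabs_p_expn_small (mulr_gt0 e0 (pabs_fact_gt0 M)).
exists M' => N a b MN.
apply: (pabsB_trans (MP _ (zmn _))); rewrite pabsBC.
apply: (pabsB_trans (MP _ (zmn _))); rewrite -sumrB.
apply: pabs_sum_le => [|n]; first exact: ltW.
rewrite mem_index_iota => /andP[_ nM]; rewrite -mulrBl pabsM pabsX.
rewrite -[e]mulr1 ler_pM ?exprn_ge0 ?pabs_ge0//; last first.
  by case/andP: a01 => a0 /ltW a1; rewrite exprn_ile1.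
apply: gbinomB_le; rewrite ?near_nat_le1 ?(ltW e0)//.
rewrite opprD addrACA subrr add0r natrD opprD addrA subrr add0r pabsN.
apply: (le_trans (MP' _ MN _)); rewrite ler_wpM2l ?(ltW e0)//.
rewrite (_ : M`! = n`! * (M ^_ (M - n)))%N; last first.
  by rewrite mulnC -(ffact_fact (leq_subr n M)) subKn// ltnW.
by rewrite natrM pabsM ler_piMr ?pabs_ge0// pabs_nat_le1.
Qed.

Lemma qnum_uniform (z : C) : near_nat z ->
  padic_uniform (fun m => qnum q (z + m%:R)).
Proof.
move=> zn e e0; rewrite /qnum; have [_|q1] := eqVneq q 1.
  have [M MP] := pabs_p_expn_small e0; exists M => N a b MN.
  by rewrite opprD addrACA subrr add0r natrD addrAC subrr add0r MP.
have q10 : 0 < pabs (1 - q) by rewrite pabs_gt0// subr_eq0 eq_sym.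
have [M MP] := qpow_uniform zn (mulr_gt0 e0 q10); exists M => N a b MN.
rewrite -mulrBl pabsM pabsV ler_pdivrMr// opprD addrACA subrr add0r opprK.
by rewrite addrC pabsBC MP.
Qed.

Lemma qnum_bounded (z : C) : near_nat z ->
  exists B, forall m, pabs (qnum q (z + m%:R)) <= B.
Proof.
move=> zn; have zmn m : near_nat (z + m%:R).
  by rewrite -[z]mul1r; exact: (@near_nat_affine z m 1).
rewrite /qnum; have [_|q1] := eqVneq q 1.
  by exists 1 => m; rewrite near_nat_le1.
exists (pabs (1 - q)^-1) => m; rewrite pabsM ler_piMl ?pabs_ge0//.
by rewrite pabsD_le ?pabs1// pabsN qpow_le1.
Qed.

End Qpow.

Lemma padic_uniformX f B n : (forall m, pabs (f m) <= B) -> padic_uniform f ->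
  padic_uniform (fun m => f m ^+ n).
Proof.
move=> fB fu; elim: n => [|n IH] e e0.
  by exists 0%N => N a b _; rewrite !expr0 subrr pabs0 ltW.
have B0 : 0 <= B by exact: le_trans (pabs_ge0 (f 0%N)) (fB _).
have B1 : 0 < 1 + B by rewrite ltr_pwDl.
have Bn1 : 0 < 1 + B ^+ n by rewrite ltr_pwDl ?exprn_ge0.
have [M MP] := fu _ (divr_gt0 e0 Bn1).
have [M' MP'] := IH _ (divr_gt0 e0 B1).
exists (maxn M M') => N a b; rewrite geq_max => /andP[MN MN'].
(* The intermediate term changes the power first and the single factor next; the tolerances were
   divided by $1+B$ and $1+B^n$ for these two moves. *)
rewrite !exprS; apply: (@pabsB_trans _ _ (f (a + p ^ N * b)%N * f a ^+ n)).
  rewrite -mulrBr pabsM mulrC -[e](divfK (lt0r_neq0 B1)) ler_pM ?pabs_ge0 ?MP'//.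
  by rewrite (le_trans (fB _))// lerDr.
rewrite -mulrBl pabsM -[e](divfK (lt0r_neq0 Bn1)) ler_pM ?pabs_ge0 ?MP// pabsX.
by rewrite (@le_trans _ _ (B ^+ n)) ?lerDr// lerXn2r ?nnegrE ?pabs_ge0.
Qed.

(** * Density of the naturals in [padicZ] *)

Lemma pabs_nat_coprime k : coprime p k -> pabs (k%:R : C) = 1.
Proof.
move=> pk; apply/eqP; rewrite eq_le pabs_nat_le1/= leNgt; apply/negP => k_lt1.
have [u v uv _] := egcdnP k (prime_gt0 p_prime).
have : pabs (1 : C) < 1.
  (* By this Bezout relation, $|k|<1$ and $|p|<1$ would force $|1|<1$. *)
  rewrite (_ : 1 = (u * p)%:R - (v * k)%:R); last first.
    by rewrite uv (eqP pk) natrD addrC addKr.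
  rewrite (le_lt_trans (pabsD _ _))// gt_max pabsN !natrM !pabsM.
  rewrite !(le_lt_trans (ler_piMl (pabs_ge0 _) (pabs_nat_le1 _ _)))//;
  exact: pabs_p_lt1.
by rewrite pabs1 ltxx.
Qed.

Lemma near_nat_int (z : int) : near_nat z%:~R.
Proof.
move=> e /pabs_p_expn_small[M /(_ M (leqnn M)) MP].
case: z => [k|k].
  by exists k; rewrite -pmulrn subrr pabs0 (le_trans _ (MP 0%N)) ?pabs_ge0.
(* A negative integer is made natural by adding a multiple of $p^M$. *)
exists (p ^ M * k.+1 - k.+1)%N; rewrite NegzE mulrNz natrB.
  by rewrite -pmulrn opprB addKr pabsN MP.
by rewrite leq_pmull// expn_gt0 prime_gt0.
Qed.

Lemma near_nat_rat (s : rat) : pabs (ratr s : C) <= 1 -> near_nat (ratr s).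
Proof.
move=> s1 e e0; have den0 : (0 < `|denq s|)%N by rewrite absz_gt0 denq_neq0.
have denE : (denq s)%:~R = `|denq s|%:R :> C by rewrite -[denq s]absz_denq.
have den_neq0 : (`|denq s|%:R : C) != 0 by rewrite natr_padic_neq0.
(* If [p] divided the denominator, the numerator would have absolute value 1 and [s] absolute value
   greater than 1. *)
have p_den : coprime p `|denq s|.
  rewrite prime_coprime//; apply/negP => p_dvd.
  have p_num : coprime p `|numq s|.
    rewrite prime_coprime//; apply/negP => p_dvd'.
    have := coprime_num_den s; rewrite /coprime => /eqP gcd1.
    have : (p %| 1)%N by rewrite -gcd1 dvdn_gcd p_dvd' p_dvd.
    by rewrite dvdn1 => /eqP p1; move: p_prime; rewrite p1.
  have num1 : pabs ((numq s)%:~R : C) = 1.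
    rewrite -(pabs_nat_coprime p_num); case: (numq s) => k //.
    by rewrite NegzE mulrNz pabsN abszN.
  have den_lt1 : pabs (`|denq s|%:R : C) < 1.
    have /dvdnP[k ->] := p_dvd; rewrite natrM pabsM.
    rewrite (le_lt_trans (ler_piMl (pabs_ge0 _) (pabs_nat_le1 _ _)))//.
    exact: pabs_p_lt1.
  move: s1; rewrite /ratr pabsM pabsV num1 mul1r denE invf_le1 ?pabs_gt0//.
  by rewrite leNgt den_lt1.
have [M MP] := pabs_p_expn_small e0; have {MP} := MP M (leqnn M) => MP.
(* [d] inverts the denominator modulo $p^M$, so the integer [numq s * d] approximates [s]. *)
have [d d'] := egcdnP (p ^ M) den0.
have -> : gcdn `|denq s| (p ^ M) = 1%N.
  by apply/eqP; rewrite -/(coprime _ _) coprimeXr// coprime_sym.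
move=> dd' _; have [k dk] := near_nat_int (numq s * d) e0; exists k.
apply: pabsB_trans dk; rewrite (_ : _ - _ = - (ratr s * (p ^ M * d')%:R)).
  by rewrite pabsN pabsM (le_trans _ (MP d'))// ler_piMl ?pabs_ge0.
have dE : (p ^ M * d')%:R = (d * `|denq s|)%:R - 1 :> C.
  by rewrite dd' natrD addrK mulnC.
rewrite dE natrM mulrBr mulr1 opprB intrM; congr (_ - _).
by rewrite /ratr denE mulrCA divfK// mulrC.
Qed.

Lemma padicZ_near_nat (z : C) : padicZ z -> near_nat z.
Proof.
move=> [zQ z1] e e0; pose d := Num.min e 1.
(* The cap at 1 in [d] ensures that the approximating rational has absolute value at most 1. *)
have d0 : 0 < d by rewrite lt_min e0 ltr01.
have [_ [[s _ <-]]] := zQ _ (nbhsx_ballx z d d0).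
rewrite ball_pabs/= lt_min => /andP[zs_e zs_1].
have [|k sk] := @near_nat_rat s _ e e0; last first.
  by exists k; exact: pabsB_trans (ltW zs_e) sk.
by rewrite -(subrK z (ratr s)) pabsD_le// pabsBC ltW.
Qed.

Lemma qnum_mulE (q u : C) w : (0 < w)%N -> qnum_mul q w u = qnum q (w%:R * u).
Proof.
move=> w0; rewrite /qnum_mul; case: ifPn => // qw1; rewrite /qnum /qnum_base.
have q1 : q != 1 by apply: contraNneq qw1 => ->; rewrite expr1n.
by rewrite (negbTE q1) qpow_nat// mulrC mulrA divfK// subr_eq0 eq_sym.
Qed.

End Padic.

(** Multiplying the argument by [w1] gives $w_1w_2x + w_2J + w_1Y$: the part $w_2J$ is produced by
    [twist w1 w2], the part $w_1Y$ by [fermi w1], both from base point 0. *)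
Lemma sum_fermionic_exp (p : nat) (R : realType) (C : padicComplex p R)
    (p_prime : prime p) (q x : C) (r n w1 w2 : nat) (w1_gt0 : (0 < w1)%N) :
  \sum_(j : {ffun 'I_r -> 'I_w1})
    (-1) ^+ (\sum_(i < r) j i)%N *
    fermionic_exp (fun ys : r.-tuple C =>
      qnum_mul q w1
        (w2%:R * x + w2%:R / w1%:R * (\sum_(i < r) j i)%N%:R
         + \sum_(i < r) tnth ys i)) n =
  iter r (twist w1 w2) (iter r (fermi w1)
    (fun m => qnum q ((w1 * w2)%:R * x + m%:R) ^+ n)) 0%N / n`!%:R.
Proof.
rewrite -sum_ffun_twist mulr_suml; apply: eq_bigr => j _.
rewrite -[RHS]mulrA /fermionic_exp; congr (_ * (_ / _)); rewrite add0n.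
apply: fermionic_integraln_iter => ys.
rewrite qnum_mulE//; congr (qnum q _ ^+ n).
have w1_neq0 : (w1%:R : C) != 0 by rewrite natr_padic_neq0.
rewrite !mulrDr mulrA -natrM -addrA; congr (_ + _).
rewrite natrD !natrM; congr (_ + _).
  by rewrite mulrA mulrCA mulfV// mulr1.
congr (_ * _); rewrite natr_sum big_tuple.
by apply: eq_bigr => i _; rewrite tnth_map.
Qed.

Theorem theorem1 (p : nat) (R : realType) (C : padicComplex p R)
    (p_prime : prime p) (q : C) (q_lt1 : pabs (1 - q) < 1) (r : nat)
    (x : C) (x_Zp : padicZ x) (w1 w2 : nat)
    (w1_odd : w1 = 1 %[mod 2]) (w2_odd : w2 = 1 %[mod 2]) :
  forall n : nat,
    \sum_(j : {ffun 'I_r -> 'I_w1})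
      (-1) ^+ (\sum_(i < r) j i)%N *
      fermionic_exp (fun ys : r.-tuple C =>
        qnum_mul q w1
          (w2%:R * x + w2%:R / w1%:R * (\sum_(i < r) j i)%N%:R
           + \sum_(i < r) tnth ys i)) n
    =
    \sum_(j : {ffun 'I_r -> 'I_w2})
      (-1) ^+ (\sum_(i < r) j i)%N *
      fermionic_exp (fun ys : r.-tuple C =>
        qnum_mul q w2
          (w1%:R * x + w1%:R / w2%:R * (\sum_(i < r) j i)%N%:R
           + \sum_(i < r) tnth ys i)) n.
Proof.
move=> n.
have odd_mod2 w : w = 1 %[mod 2] -> odd w by rewrite !modn2; case: (odd w).
have {w1_odd w2_odd} [w1_odd w2_odd] := (odd_mod2 _ w1_odd, odd_mod2 _ w2_odd).
(* Both sides now involve the same function of [m], with constant part $w_1w_2x$. *)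
rewrite !sum_fermionic_exp ?odd_gt0// [(w2 * w1)%N]mulnC.
have xn : near_nat ((w1 * w2)%:R * x).
  rewrite -[_ * x]addr0.
  exact: (near_nat_affine 0 _ (padicZ_near_nat p_prime x_Zp)).
have [B qB] := qnum_bounded p_prime q_lt1 xn.
rewrite iter_twist_fermi_sym//.
by apply: (padic_uniformX _ qB); exact: qnum_uniform.
Qed.
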